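(* Let $r$ define a locally subdiagonal rank selection scheme (LsD rule), applied to the sequence $X_1,X_2,\ldots$. Let $N\ge 1$ be an integer, either predetermined or random (for example a stopping time). Then the $r(L_N)$ best observations among $X_1,\ldots,X_N$ belong to the retained set; that is, (almost surely) for every $i\in\{1,\ldots,N\}$ with $R_i^N\le r(L_N)$ one has $i\in S_N$.
   Context: $X_1,X_2,\ldots$ is a sequence of real random variables such that, for every $n$, all $n!$ orderings of $X_1,\ldots,X_n$ are equally likely (in particular there are almost surely no ties). Smaller values are better. The rank of $X_i$ among the first $n$ observations is $R_i^n=\sum_{j=1}^n I\{X_j\le X_i\}$ for $1\le i\le n$ (rank 1 is best). A locally subdiagonal rank selection scheme (LsD rule) is determined by an integer-valued function $r$ on $\{0,1,2,\ldots\}$ such that: (i) $r$ is nondecreasing; (ii) $r(0)=1$; (iii) $r(a+1)\le r(a)+1$ for all $a\ge 0$. Writing $S_n$ for the set of indices of the observations retained after $n$ observations have been seen and $L_n=|S_n|$ (with $S_0=\emptyset$, $L_0=0$), the rule is: (iv) for $n\ge 1$, $X_n$ is retained (i.e. $S_n=S_{n-1}\cup\{n\}$) if and only if $R_n^n\le r(L_{n-1})$; otherwise $S_n=S_{n-1}$. *)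

(* Defs.v *)
From mathcomp Require Import all_boot all_order all_algebra all_fingroup.
From mathcomp Require Import finmap.
From mathcomp Require Import all_classical all_reals all_analysis.

Set Implicit Arguments.
Unset Strict Implicit.
Unset Printing Implicit Defensive.

Import Order.TTheory GRing.Theory Num.Theory.

Local Open Scope classical_set_scope.
Local Open Scope ring_scope.

(* Observations are numbered from 1; the term of index 0 of every sequence of
   observations is ignored. *)

(* The permutation [s] lists the indices of the first [n] observations from the
   best (smallest) to the worst, up to the shift from 'I_n to 1, ..., n. *)
Definition ordering_event d (T : measurableType d) (R : realType)
    (X : nat -> T -> R) (n : nat) (s : 'S_n) : set T :=
  [set w | forall i j : 'I_n, (i < j)%N -> X (s i).+1 w < X (s j).+1 w].

(* The [n`!] strict orderings are disjoint, so the common value [1 / n`!] makes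
   their total probability 1 and ties almost surely do not occur. *)
Definition equally_likely_orderings d (T : measurableType d) (R : realType)
    (P : probability T R) (X : nat -> T -> R) : Prop :=
  forall (n : nat) (s : 'S_n), P (ordering_event X s) = ((n`!%:R)^-1)%:E.

Definition rank (R : realType) (x : nat -> R) (n i : nat) : nat :=
  (\sum_(1 <= j < n.+1) (x j <= x i)%R)%N.

Definition locally_subdiagonal (r : nat -> int) : Prop :=
  [/\ {homo r : a b / (a <= b)%N >-> a <= b},
      r 0%N = 1 &
      forall a : nat, r a.+1 <= r a + 1].

Fixpoint retained (R : realType) (r : nat -> int) (x : nat -> R) (n : nat)
    : {fset nat} :=
  if n is m.+1 then
    let S := retained r x m in
    if (rank x n n)%:Z <= r #|` S| then (n |` S)%fset else S
  else fset0.

Definition num_retained (R : realType) (r : nat -> int) (x : nat -> R)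
    (n : nat) : nat := #|` retained r x n|.

(* Main.v *)
(* The inclusion holds pathwise at every time n, hence at a random time, by
   induction on n.  If observation n + 1 is rejected, neither L nor the set
   changes and ranks can only grow.  If it is retained, consider an older
   observation i.  When X_{n+1} <= X_i, the rank of i grew by 1, as much as r(L)
   can; when X_i < X_{n+1}, the rank of i is at most that of n + 1, hence at
   most r(L_n). *)

Require Import Defs.
From mathcomp Require Import all_boot all_order all_algebra all_fingroup.
From mathcomp Require Import finmap.
From mathcomp Require Import all_classical all_reals all_analysis.

Set Implicit Arguments.
Unset Strict Implicit.
Unset Printing Implicit Defensive.

Import Order.TTheory GRing.Theory Num.Theory.

Local Open Scope classical_set_scope.
Local Open Scope ring_scope.

Lemma rankS (R : realType) (x : nat -> R) (n i : nat) :
  rank x n.+1 i = (rank x n i + (x n.+1 <= x i)%R)%N.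
Proof. by rewrite /rank big_nat_recr. Qed.

Lemma rank_homo (R : realType) (x : nat -> R) (n i j : nat) :
  x i <= x j -> (rank x n i <= rank x n j)%N.
Proof.
move=> xij; apply: leq_sum => k _.
by case: (leP (x k) (x i)) => [/le_trans/(_ xij) ->|].
Qed.

Lemma best_retained (R : realType) (r : nat -> int) (x : nat -> R) (n i : nat) :
  locally_subdiagonal r -> (1 <= i <= n)%N ->
  (rank x n i)%:Z <= r (num_retained r x n) -> i \in retained r x n.
Proof.
case=> _ _ r_step; elim: n => [|n IHn]; first by case: i.
case/andP=> i_gt0; rewrite leq_eqVlt ltnS /num_retained /=.
case: ifPn => [n_kept|n_rejected] /predU1P[->|i_le_n] rank_i.
- exact: fset1U1.
- apply: fset1Ur; apply: IHn; first by rewrite i_gt0.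
  have [x_le|x_gt] := leP (x n.+1) (x i); last first.
    apply: le_trans n_kept; rewrite lez_nat.
    apply: leq_trans (rank_homo n.+1 (ltW x_gt)).
    by rewrite rankS leq_addr.
  rewrite -(lerD2r 1); move: rank_i; rewrite rankS x_le PoszD.
  move=> /le_trans; apply; rewrite cardfsU1.
  (* That [n.+1] is a new index is not established; both cases are settled instead. Either the set
     grows by one and [r_step] applies, or its size is unchanged and the bound is
     [r L <= r L + 1]. *)
  by case: (_ \notin _); rewrite ?add0n ?add1n ?r_step // lerDl.
(* Rejection leaves the retained set as it was, so for the newest observation [rank_i] is exactly
   the acceptance test that failed. *)
- by rewrite rank_i in n_rejected.
- apply: IHn; first by rewrite i_gt0.
  by apply: le_trans rank_i; rewrite lez_nat rankS leq_addr.
Qed.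

Theorem theorem2p1 (d : measure_display) (T : measurableType d) (R : realType)
    (P : probability T R) (X : nat -> {RV P >-> R})
    (hX : equally_likely_orderings P (fun i => X i))
    (r : nat -> int) (hr : locally_subdiagonal r)
    (N : {RV P >-> nat}) (hN : forall w : T, (1 <= N w)%N) :
  {ae P, forall w : T, let x := fun i : nat => X i w in
    forall i : nat, (1 <= i <= N w)%N ->
      (rank x (N w) i)%:Z <= r (num_retained r x (N w)) ->
      i \in retained r x (N w)}.
Proof. by apply: aeW => w x i; apply: best_retained. Qed.
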